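(* Let $\Gamma\curvearrowright X$ be a minimal action of a countable discrete group $\Gamma$ by homeomorphisms on a compact metrizable space $X$ of finite Lebesgue covering dimension. Then $\Gamma\curvearrowright X$ has the small boundary property.
   Context: An action of a discrete group $\Gamma$ on a compact space $X$ has the small boundary property if there is a basis $\mathcal B$ for the topology of $X$ such that for every $B\in\mathcal B$ and every $\Gamma$-invariant Borel probability measure $\mu$ on $X$, one has $\mu(\partial B)=0$. The action is minimal if $\emptyset$ and $X$ are the only closed $\Gamma$-invariant subsets of $X$. *)

(* Defs.v *)
From HB Require Import structures.
From mathcomp Require Import all_boot all_order all_algebra.
From mathcomp Require Import all_classical all_reals all_analysis.

Set Implicit Arguments.
Unset Strict Implicit.
Unset Printing Implicit Defensive.

Import Order.TTheory GRing.Theory Num.Theory.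

Local Open Scope classical_set_scope.
Local Open Scope ring_scope.

Section Topology.
Context {X : topologicalType}.

Definition metrizable (R : realType) : Prop :=
  exists d : X -> X -> R,
    [/\ forall x y, d x y = 0 <-> x = y,
        forall x y, d x y = d y x,
        forall x y z, d x z <= d x y + d y z
      & forall x, nbhs x =
          filter_from [set e : R | 0 < e] (fun e => [set y | d x y < e])].

Definition boundary (A : set X) : set X := closure A `\` interior A.

Definition open_cover (U : set (set X)) : Prop :=
  U `<=` open /\ \bigcup_(A in U) A = [set: X].

Definition refines (V U : set (set X)) : Prop :=
  forall A, V A -> exists2 B, U B & A `<=` B.

(* Every point lies in at most n+1 members of the refinement. *)
Definition covering_dim_le (n : nat) : Prop :=
  forall U, open_cover U ->
    exists V, [/\ open_cover V, refines V U
                & forall x, ([set A | V A /\ A x] #<= `I_n.+1)%card].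

Definition finite_covering_dim : Prop := exists n, covering_dim_le n.

End Topology.

Arguments metrizable : clear implicits.
Arguments covering_dim_le : clear implicits.
Arguments finite_covering_dim : clear implicits.

(* Measurable types are pointed, whereas a topological space may be empty. Since
   only a nonempty space carries a probability measure, the Borel space of X is
   formed at a base point x0; its sigma-algebra does not depend on x0. *)
Definition pointed_at (T : Type) (x0 : T) : Type := T.

HB.instance Definition _ (T : choiceType) (x0 : T) :=
  Choice.on (pointed_at x0).
HB.instance Definition _ (T : choiceType) (x0 : T) :=
  isPointed.Build (pointed_at x0) x0.

Definition borel (X : topologicalType) (x0 : X) :=
  g_sigma_algebraType (@open X : set (set (pointed_at x0))).

Section Actions.
Context {G : groupType} {X : topologicalType}.
Implicit Type act : G -> X -> X.

(* Each [act g] is then a homeomorphism, with inverse [act g^-1]. *)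
Definition continuous_action act : Prop :=
  [/\ forall x, act 1%g x = x,
      forall g h x, act (g * h)%g x = act g (act h x)
    & forall g, continuous (act g)].

Definition invariant_set act (A : set X) : Prop :=
  forall g, act g @` A = A.

Definition minimal_action act : Prop :=
  forall A, closed A -> invariant_set act A -> A = set0 \/ A = [set: X].

Definition invariant_measure act (R : realType) (x0 : X)
    (mu : probability (borel x0) R) : Prop :=
  forall g (A : set (borel x0)), measurable A -> mu (act g @^-1` A) = mu A.

Definition small_boundary_property act (R : realType) : Prop :=
  exists2 B : set (set X), basis B &
    forall U, B U ->
    forall (x0 : X) (mu : probability (borel x0) R),
      invariant_measure act mu -> mu (boundary U) = 0%E.

End Actions.

(* Main.v *)
Require Import Defs.
From mathcomp Require Import all_boot all_order all_algebra.
From mathcomp Require Import all_classical all_reals all_analysis.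
From mathcomp Require Import measurable_realfun zify lra.

Local Open Scope classical_set_scope.

(** Each orbit closure is closed and invariant, so by minimality it is X. If
    some orbit is finite then X is that orbit, hence discrete, and boundaries of
    open sets are empty. From now on all orbits are infinite; let n bound the
    covering dimension of X.

    The key point is that X has a basis of open sets U whose boundary meets each
    orbit in at most n points ([bounded_multiplicity_partition]). To separate a
    point x from the complement of a neighbourhood, start with two open sets P
    and Q with disjoint closures and enlarge them in countably many steps; at the
    end U is the union of the P's, and the boundary of U lies in the part of X
    that is never covered. A step deals with one open set O and one tuple
    g_0, ..., g_n of group elements for which the translates g_i (closure O) are
    pairwise disjoint, and arranges that no y in O has all of
    g_0 y, ..., g_n y uncovered ([extend_off_translates]). As the translates are
    disjoint, the pair (P, Q) can be enlarged independently on each of them;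
    pulled back to O this asks for n+1 partitions between n+1 pairs of disjoint
    closed sets such that the partitions have no common point. By a classical
    theorem of Eilenberg and Otto this is possible in dimension at most n
    ([empty_intersection_of_partitions]). Only distinctness of the points g_i y
    matters, so stabilisers cause no difficulty. Countably many steps suffice
    because X has a countable base and the group is countable.

    A closed set A that meets each orbit in at most n points is null for each
    invariant probability measure ([null_of_bounded_multiplicity]): let each
    point of A send N copies of its mass to N distinct points of its orbit. The
    total mass sent is N mu(A), and no point of X receives more than n times its
    own mass, so N mu(A) <= n for all N. *)

Set Implicit Arguments.
Unset Strict Implicit.
Unset Printing Implicit Defensive.

Import Order.TTheory GRing.Theory Num.Theory.

Local Open Scope ring_scope.

(** * Metrics and Lebesgue numbers *)

(** The condition of [metrizable] for one fixed d, so that several lemmas can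
    speak of the same metric. *)
Definition compatible_metric (R : realType) (X : topologicalType)
    (d : X -> X -> R) : Prop :=
  [/\ forall x y, d x y = 0 <-> x = y,
      forall x y, d x y = d y x,
      forall x y z, d x z <= d x y + d y z
    & forall x, nbhs x =
        filter_from [set e : R | 0 < e] (fun e => [set y | d x y < e])].

Lemma metricxx (R : realType) (X : topologicalType) (d : X -> X -> R) x :
  compatible_metric d -> d x x = 0.
Proof. by case=> d0 _ _ _; exact/d0. Qed.

Lemma nbhs_metric (R : realType) (X : topologicalType) (d : X -> X -> R) x r :
  compatible_metric d -> 0 < r -> nbhs x [set y | d x y < r].
Proof. by case=> _ _ _ -> r0; exists r. Qed.

Lemma open_metric_ball (R : realType) (X : topologicalType) (d : X -> X -> R)
    x r : compatible_metric d -> open [set y | d x y < r].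
Proof.
move=> dP; have [_ _ dtri _] := dP.
rewrite openE => y /= xy; have ry : 0 < r - d x y by rewrite subr_gt0.
apply: filterS (nbhs_metric y dP ry) => z /=; rewrite ltrBrDl.
exact: le_lt_trans.
Qed.

Lemma metric_hausdorff (R : realType) (X : topologicalType) (d : X -> X -> R) :
  compatible_metric d -> hausdorff_space X.
Proof.
move=> dP; have [d0 dC dtri _] := dP => x y xy; apply/d0.
apply/eqP; rewrite eq_le; apply/andP; split; last first.
  have := dtri x y x; rewrite (metricxx x dP) (dC y x) -mulr2n.
  by rewrite pmulrn_lge0.
apply/ler_addgt0Pr => e e0; rewrite add0r.
have e2 : 0 < e / 2 by rewrite divr_gt0.
have [z [/= xz yz]] := xy _ _ (nbhs_metric x dP e2) (nbhs_metric y dP e2).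
rewrite (le_trans (dtri x z y))// (splitr e) (dC z) ltW// ltrD//.
Qed.

(** Near x the radius e / 2 works for all points at once when the e-ball at x lies
    in a member of V; compactness makes the radius uniform. *)
Lemma lebesgue_number (R : realType) (X : topologicalType) (d : X -> X -> R)
    (V : set (set X)) :
  compatible_metric d -> compact [set: X] -> open_cover V ->
  exists2 l, 0 < l & forall x, exists2 A, V A & forall y, d x y < l -> A y.
Proof.
move=> dP /compact_near_coveringP cX [Vopen Vcover].
have [_ _ dtri nbhsE] := dP.
pose P (l : R) x := exists2 A, V A & forall y, d x y < l -> A y.
have lebP : \forall l \near 0^'+, [set: X] `<=` P l.
  apply: cX => x _.
  have [A VA Ax] : (\bigcup_(A in V) A) x by rewrite Vcover.
  have : nbhs x A by apply: open_nbhs_nbhs; split => //; exact: Vopen.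
  rewrite nbhsE => -[e /= e0 eA]; have e2 : 0 < e / 2 by rewrite divr_gt0.
  exists ([set y | d x y < e / 2], [set l : R | l < e / 2]).
    by split; [exact: nbhs_metric|exact: nbhs_right_lt].
  move=> [y l] /= [xy le]; exists A => // z yz; apply: eA => /=.
  by rewrite (le_lt_trans (dtri x y z))// (splitr e) ltrD// (lt_trans yz).
have [l [l0 lP]] := filter_ex (filterI (nbhs_right_gt (0:R)) lebP).
by exists l => // x; exact: lP.
Qed.

(** * Partitions with empty intersection *)

(** The complement of the two open sets is a partition, in the sense of dimension
    theory, between any two sets that they contain. *)
Definition separated_opens (X : topologicalType) (S : set X * set X) : Prop :=
  [/\ open S.1, open S.2 & closure S.1 `&` closure S.2 = set0].

(** Take a cover V of order n+1 no member of which meets both C_i and D_i. Let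
    e be a small fraction of a Lebesgue number of V, and let L i k be the set of
    points whose ball of radius k e lies in a member of V meeting C_i. The i-th
    partition is put where L i changes between k = 4i+1 and k = 4i+4. A point x
    on the i-th partition then has a member V_i whose inner margin at x (the
    distance from x to its complement) is between (4i+1) e and (4i+4) e. These
    ranges are disjoint, so the V_i are distinct, and a common point x of all
    n+1 partitions would lie in n+1 different V_i. But x also lies in a member
    whose margin is at least the Lebesgue number: that makes n+2. *)
Lemma empty_intersection_of_partitions (R : realType) (X : topologicalType)
    (d : X -> X -> R) (n : nat) (C D : 'I_n.+1 -> set X) :
  compatible_metric d -> compact [set: X] -> covering_dim_le X n ->
  (forall i, closed (C i)) -> (forall i, closed (D i)) ->
  (forall i, C i `&` D i = set0) ->
  exists S : 'I_n.+1 -> set X * set X,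
    [/\ forall i, separated_opens (S i),
        forall i, C i `<=` (S i).1,
        forall i, D i `<=` (S i).2
      & forall x, exists i, ((S i).1 `|` (S i).2) x].
Proof.
move=> dP cX dimX clC clD CD; have [_ dC dtri nbhsE] := dP.
pose U : set (set X) :=
  [set A | open A /\ forall i, A `&` C i = set0 \/ A `&` D i = set0].
have Uc : open_cover U.
  split; first by move=> A [].
  apply/seteqP; split=> // x _.
  pose B i := if `[<C i x>] then ~` D i else ~` C i.
  exists (\bigcap_(i in [set: 'I_n.+1]) B i); last first.
    move=> i _; rewrite /B; case: asboolP => // Cx Dx.
    by have : (C i `&` D i) x by []; rewrite CD.
  split.
    rewrite -closedC setC_bigcap; apply: closed_bigcup => [|i _].
      exact: finite_finset.
    by rewrite closedC /B; case: asboolP => _; rewrite openC.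
  move=> i; case: (pselect (C i x)) => Cx; [right|left];
    apply/seteqP; split=> // y [/(_ i I)]; rewrite /B; case: asboolP => //.
have [V [[Vopen Vcover] VU Vord]] := dimX _ Uc.
have [l l0 lP] := lebesgue_number dP cX (conj Vopen Vcover).
(* The levels 4i+1, ..., 4i+4 with i <= n stay below 4n+5, where the radius
   reaches the Lebesgue number l. *)
pose e := l / (4 * n + 5)%:R.
have e0 : 0 < e by rewrite divr_gt0// ltr0n addn_gt0 orbT.
have e2 : 0 < e / 2 by rewrite divr_gt0.
have leE : l = (4 * n + 5)%:R * e.
  by rewrite /e mulrC divfK// pnatr_eq0 addn_eq0 andbF.
pose L (i : 'I_n.+1) k := [set x | exists A,
  [/\ V A, A `&` C i !=set0 & forall y, d x y < k%:R * e -> A y]].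
have Lshift i k x y : d x y < e -> L i k.+1 x -> L i k y.
  move=> xy [A [VA AC Ax]]; exists A; split=> // z yz; apply: Ax.
  by rewrite (le_lt_trans (dtri x y z))// -natr1 mulrDl mul1r addrC ltrD.
have Lin i x : C i x -> L i (4 * i + 4)%N x.
  move=> Cx; have [A VA Al] := lP x; exists A; split=> //.
    by exists x; split=> //; apply: Al; rewrite (metricxx x dP).
  move=> y xy; apply: Al; apply: lt_le_trans xy _.
  rewrite leE ler_pM2r// ler_nat; have := ltn_ord i.
  lia.
have Lout i k x : D i x -> ~ L i k.+1 x.
  move=> Dx [A [VA AC Ax]]; have [B [_ /(_ i) BCD] AB] := VU _ VA.
  have Bx : B x.
    by apply/AB/Ax; rewrite (metricxx x dP) mulr_gt0// ltr0n.
  case: BCD => B0; last by have : (B `&` D i) x by []; rewrite B0.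
  by have [z [/AB Bz Cz]] := AC; have : (B `&` C i) z by []; rewrite B0.
exists (fun i => ((L i (4 * i + 3)%N)°, (~` L i (4 * i + 2)%N)°)).
split=> /=.
- move=> i; split=> /=; [exact: open_interior|exact: open_interior|].
  apply/seteqP; split=> // y [/= yP yQ].
  have [p [/interior_subset pL /= yp]] := yP _ (nbhs_metric y dP e2).
  have [q [/interior_subset qL /= yq]] := yQ _ (nbhs_metric y dP e2).
  apply: qL; apply: (@Lshift _ _ p); last by rewrite -addnS.
  by rewrite (le_lt_trans (dtri p y q))// (splitr e) (dC p) ltrD.
- move=> i x /Lin Lx; apply: filterS (nbhs_metric x dP e0) => y /= xy.
  by apply: (Lshift _ _ _ _ xy); rewrite -addnS.
- move=> i x Dx; apply: filterS (nbhs_metric x dP e0) => y /= xy Ly.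
  apply: (@Lout i (4 * i)%N x Dx).
  by apply: (@Lshift _ _ y); [rewrite dC|rewrite -addn2].
move=> x; apply: contrapT => xS.
have xP i : ~ L i (4 * i + 4)%N x.
  move=> Lx; apply: xS; exists i; left.
  apply: filterS (nbhs_metric x dP e0) => y /= xy.
  by apply: (Lshift _ _ _ _ xy); rewrite -addnS.
have xQ i : L i (4 * i + 1)%N x.
  apply: contrapT => Lx; apply: xS; exists i; right.
  apply: filterS (nbhs_metric x dP e0) => y /= xy Ly; apply: Lx.
  by apply: (@Lshift _ _ y); [rewrite dC|rewrite -addnS].
(* The member V_j for j <= n; the index n+1 stands for the member given by the
   Lebesgue number, for which no upper bound on the margin is asked. *)
have : forall j : nat, exists A, (j < n.+2)%N ->
    [/\ V A, forall y, d x y < (4 * j + 1)%:R * e -> A y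
      & (j < n.+1)%N -> ~ forall y, d x y < (4 * j + 4)%:R * e -> A y].
  move=> j; have [jn|jn] := ltnP j n.+1.
    have [A [VA AC Ax]] := xQ (Ordinal jn); exists A => _; split=> // _ Ax'.
    by apply: (xP (Ordinal jn)); exists A.
  have [A VA Al] := lP x; exists A => jn2; split=> // y xy; apply: Al.
  rewrite leE; apply: lt_le_trans xy _; rewrite ler_pM2r// ler_nat.
  lia.
move=> /choice[f fP].
have finj i j : (i < j)%N -> (j < n.+2)%N -> f i <> f j.
  move=> ij jn fij; have [_ _ fi] := fP i (ltn_trans ij jn).
  have [_ fj _] := fP j jn.
  apply: (fi (leq_trans ij jn)) => y xy; rewrite fij; apply: fj.
  apply: lt_le_trans xy _.
  by rewrite ler_pM2r// ler_nat; lia.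
have : (`I_n.+2 #<= `I_n.+1)%card.
  apply: card_le_trans (Vord x).
  have fI : (f @` `I_n.+2 #= `I_n.+2)%card.
    apply: inj_card_eq => i j /set_mem /= iI /set_mem /= jI fij.
    have [ij|ji|//] := ltngtP i j; first by have := finj _ _ ij jI fij.
    by have := finj _ _ ji iI (esym fij).
  rewrite -(card_le_eql fI); apply: subset_card_le => _ [j /= jn <-].
  have [Vf fx _] := fP j jn.
  by split=> //; apply: fx; rewrite (metricxx x dP) mulr_gt0// ltr0n addn1.
by rewrite card_le_II ltnn.
Qed.

(** * Countable bases and disjoint translates *)

(** The filter F on lists is that of the lists containing a given finite set; the
    near-covering form of compactness turns membership in some W x for all large
    lists locally into the same for one list globally. *)
Lemma finite_nbhs_subcover (X : topologicalType) (W : X -> set X) :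
  compact [set: X] -> (forall x, nbhs x (W x)) ->
  exists s : seq X, forall y, exists2 x, x \in s & W x y.
Proof.
move=> /compact_near_coveringP cX xW.
pose F : set_system (seq X) :=
  [set A | exists s0 : seq X, forall s : seq X, {subset s0 <= s} -> A s].
have FF : Filter F.
  split.
  - by exists [::].
  - move=> A B [s As] [t Bt]; exists (s ++ t) => u stu; split.
    + by apply: As => x xs; apply: stu; rewrite mem_cat xs.
    + by apply: Bt => x xt; apply: stu; rewrite mem_cat xt orbT.
  - by move=> A B AB [s As]; exists s => u su; exact/AB/As.
have [|s sP] := cX _ F (fun (s : seq X) y => exists2 x, x \in s & W x y) FF.
  move=> x _; exists (W x, [set s : seq X | x \in s]) => [/=|[y s] [/= Wy xs]].
    by split=> //; exists [:: x] => s; apply; exact: mem_head.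
  by exists x.
by exists s => y; exact: (sP s (fun _ => id) y I).
Qed.

(** The balls of radius 1/(m+1) around a finite 1/(m+1)-net, for all m. *)
Lemma metric_countable_base (R : realType) (X : topologicalType)
    (d : X -> X -> R) :
  compatible_metric d -> compact [set: X] ->
  exists O : nat -> set X, (forall k, open (O k)) /\
    forall x A, nbhs x A -> exists2 k, O k x & closure (O k) `<=` A.
Proof.
move=> dP cX; have [d0 dC dtri nbhsE] := dP.
pose b m c := [set y | d c y < (m.+1%:R^-1 : R)].
have /choice[s sP] (m : nat) : exists s : seq X,
    forall x, exists2 c, c \in s & b m c x.
  have [x|s sP] := @finite_nbhs_subcover X (b m) cX; last by exists s.
  by apply: nbhs_metric => //; rewrite invr_gt0.
(* Indices that encode no ball get the empty set. *)
pose O k := if unpickle k is Some mj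
  then nth set0 (map (b mj.1) (s mj.1)) mj.2 else set0.
exists O; split=> [k|x A].
  rewrite /O; case: unpickle => [[m j]/=|]; last exact: open0.
  case: (ltnP j (size (s m))) => js; last first.
    by rewrite nth_default ?size_map//; exact: open0.
  case: (s m) js => // c0 s' js; rewrite (nth_map c0)//.
  exact: open_metric_ball.
rewrite nbhsE => -[e /= e0 eA].
have [|m] := @ltr_add_invr R 0 (e / 3); first by rewrite divr_gt0.
rewrite add0r => me; have [c cs cx] := sP m x.
exists (pickle (m, index c (s m))).
  by rewrite /O pickleK /= (nth_map x) ?index_mem// nth_index.
rewrite /O pickleK /= (nth_map x) ?index_mem// nth_index// => z clz.
have m0 : 0 < m.+1%:R^-1 :> R by rewrite invr_gt0.
have [w [cw /= zw]] := clz _ (nbhs_metric z dP m0).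
apply: eA => /=; apply: le_lt_trans (dtri x w z) _.
apply: le_lt_trans (lerD (dtri x c w) (lexx _)) _.
rewrite (dC x) (dC w); move: cx cw zw me; rewrite /b /=.
by move: (m.+1%:R^-1 : R) => r; lra.
Qed.

Definition disjoint_translates (G : groupType) (X : topologicalType)
    (act : G -> X -> X) (k : nat) (g : 'I_k -> G) (A : set X) : Prop :=
  forall i j, i != j -> forall x y, A x -> A y -> act (g i) x <> act (g j) y.

(** Separate each pair g_i x, g_j x and intersect the finitely many preimages. *)
Lemma nbhs_disjoint_translates (G : groupType) (X : topologicalType)
    (act : G -> X -> X) (k : nat) (g : 'I_k -> G) (x : X) :
  hausdorff_space X -> continuous_action act ->
  injective (fun i => act (g i) x) ->
  exists2 A, open_nbhs x A & disjoint_translates act g A.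
Proof.
rewrite open_hausdorff => hX [_ _ ctsact] ginj.
have sep (ij : 'I_k * 'I_k) : exists UV : set X * set X, ij.1 != ij.2 ->
    [/\ nbhs x (act (g ij.1) @^-1` UV.1), nbhs x (act (g ij.2) @^-1` UV.2)
      & UV.1 `&` UV.2 = set0].
  case: ij => i j /=; have [->|ij] := eqVneq i j.
    by exists (set0, set0).
  have [|[U V] /= [/set_mem xU /set_mem xV] [oU oV /eqP UV0]] :=
      hX (act (g i) x) (act (g j) x).
    by apply: contra_neq ij => /ginj.
  exists (U, V) => _ /=; split=> //; apply: ctsact;
    by apply: open_nbhs_nbhs.
have [UV UVP] := choice sep.
pose N (ij : 'I_k * 'I_k) := [set y | ij.1 != ij.2 ->
  (UV ij).1 (act (g ij.1) y) /\ (UV ij).2 (act (g ij.2) y)].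
have /nbhs_interior xN : \forall y \near x, forall ij, N ij y.
  apply: filter_forall => ij; rewrite /N; have [_|ij0] := eqVneq ij.1 ij.2.
    by apply: nearW.
  have [U1 U2 _] := UVP ij ij0.
  by apply: filterS (filterI U1 U2) => y UVy _.
exists ([set y | forall ij, N ij y]°).
  by rewrite open_nbhsE; split; [exact: open_interior|exact: xN].
move=> i j ij y z /interior_subset Ny /interior_subset Nz eqyz.
have [Uy _] := Ny (i, j) ij; have [_ Vz] := Nz (i, j) ij.
have [_ _ UV0] := UVP (i, j) ij.
have : ((UV (i, j)).1 `&` (UV (i, j)).2) (act (g i) y).
  by split=> //; rewrite eqyz.
by rewrite UV0.
Qed.

(** * Partitions that meet each orbit in few points *)

Definition extends (X : Type) (S S' : set X * set X) : Prop :=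
  S.1 `<=` S'.1 /\ S.2 `<=` S'.2.

Lemma closure_bigcup_fin (X : topologicalType) (k : nat) (A : 'I_k -> set X) :
  closure (\bigcup_(i in [set: 'I_k]) A i)
    `<=` \bigcup_(i in [set: 'I_k]) closure (A i).
Proof.
have clA : closed (\bigcup_(i in [set: 'I_k]) closure (A i)).
  apply: closed_bigcup => [|i _]; first exact: finite_finset.
  exact: closed_closure.
rewrite [X in _ `<=` X]((closure_id _).1 clA); apply: closureS.
by apply: subset_bigcup => i _; exact: subset_closure.
Qed.

Lemma closure_preimage_sub (X Y : topologicalType) (f : X -> Y) (A : set Y) :
  continuous f -> closure (f @^-1` A) `<=` f @^-1` closure A.
Proof.
move=> /continuous_closedP fP.
rewrite [X in _ `<=` X]((closure_id _).1 (fP _ (@closed_closure _ A))).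
by apply: closureS => x; exact: (@subset_closure _ A (f x)).
Qed.

(** Pull the pair S back by each g_i, take partitions T_i between the pullbacks
    without a common point, and push the part of T_i over O forward by g_i. The
    new pair keeps disjoint closures: a pushed part of T_i avoids S because T_i
    extends the pullback of S, and parts for different i lie over the disjoint
    sets g_i (closure O). *)
Lemma extend_off_translates (R : realType) (G : groupType)
    (X : topologicalType) (d : X -> X -> R) (act : G -> X -> X) (n : nat)
    (g : 'I_n.+1 -> G) (O : set X) (S : set X * set X) :
  compatible_metric d -> compact [set: X] -> covering_dim_le X n ->
  continuous_action act -> open O -> disjoint_translates act g (closure O) ->
  separated_opens S ->
  exists S', [/\ separated_opens S', extends S S'
    & forall x, O x -> exists i, (S'.1 `|` S'.2) (act (g i) x)].
Proof.
move=> dP cX dimX [act1 actM ctsact] oO Odisj [oP oQ PQ0].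
have actK h x : act (h^-1)%g (act h x) = x by rewrite -actM mulVg act1.
have actKV h x : act h (act (h^-1)%g x) = x by rewrite -actM mulgV act1.
have opre h A : open A -> open (act h @^-1` A).
  by move/continuousP : (ctsact h) => /[apply].
have clpre h A : closed A -> closed (act h @^-1` A).
  by move/continuous_closedP : (ctsact h) => /[apply].
have [||i|T [Tsep CT DT Tcover]] := @empty_intersection_of_partitions R X d n
    (fun i => act (g i) @^-1` closure S.1)
    (fun i => act (g i) @^-1` closure S.2) dP cX dimX.
- by move=> i; apply: clpre; exact: closed_closure.
- by move=> i; apply: clpre; exact: closed_closure.
- by rewrite -preimage_setI PQ0 preimage_set0.
pose move_to i A := act ((g i)^-1)%g @^-1` (A `&` O).
pose S' := (S.1 `|` \bigcup_(i in [set: 'I_n.+1]) move_to i (T i).1,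
            S.2 `|` \bigcup_(i in [set: 'I_n.+1]) move_to i (T i).2).
have omove i A : open A -> open (move_to i A).
  by move=> oA; apply: opre; exact: openI.
have clmove i A y : closure (move_to i A) y ->
    closure A (act ((g i)^-1)%g y) /\ closure O (act ((g i)^-1)%g y).
  move=> /closure_preimage_sub => /(_ (ctsact _)) /= AO.
  by split; apply: closureS AO; [exact: subIsetl|exact: subIsetr].
exists S'; split.
- have [oT1 oT2] : (forall i, open (T i).1) /\ (forall i, open (T i).2).
    by split=> i; case: (Tsep i).
  split=> /=.
  + by apply: openU => //; apply: bigcup_open => i _; exact: omove.
  + by apply: openU => //; apply: bigcup_open => i _; exact: omove.
  have noT i y : closure (T i).1 y -> closure (T i).2 y -> False.
    move=> y1 y2; have [_ _ T0] := Tsep i.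
    by have : (closure (T i).1 `&` closure (T i).2) y by []; rewrite T0.
  apply/seteqP; split=> // y [/=]; rewrite !closureU.
  case=> [y1|/closure_bigcup_fin[i _ /clmove[y1 Oy1]]];
    case=> [y2|/closure_bigcup_fin[j _ /clmove[y2 Oy2]]].
  + by have : (closure S.1 `&` closure S.2) y by []; rewrite PQ0.
  + apply: (noT j) y2; apply: subset_closure; apply: CT.
    by rewrite /= actKV.
  + apply: (noT i) y1 _; apply: subset_closure; apply: DT.
    by rewrite /= actKV.
  + have [ij|ij] := eqVneq i j; first by subst j; exact: (noT i) y1 y2.
    by apply: (Odisj _ _ ij _ _ Oy1 Oy2); rewrite !actKV.
- by split=> x Sx; left.
- move=> x Ox; have [i Tx] := Tcover x; exists i.
  by case: Tx => Tx; [left|right]; right; exists i => //; split;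
    rewrite /= actK.
Qed.

(** The tasks, one for each basic open set and each (n+1)-tuple in G, are numbered
    by nat and handled in turn by [extend_off_translates]. Since the open sets
    only grow, a task once met stays met in the union. If g_0 x, ..., g_n x are
    distinct, some basic neighbourhood of x has closure with disjoint translates
    by the g_i, so one of the tasks is about x and the g_i. *)
Lemma bounded_multiplicity_partition (R : realType) (G : groupType)
    (X : topologicalType) (d : X -> X -> R) (act : G -> X -> X) (n : nat)
    (C D : set X) :
  countable [set: G] ->
  compatible_metric d -> compact [set: X] -> covering_dim_le X n ->
  continuous_action act -> closed C -> closed D -> C `&` D = set0 ->
  exists S : set X * set X,
    [/\ [/\ open S.1, open S.2 & S.1 `&` S.2 = set0], C `<=` S.1, D `<=` S.2
      & forall x (g : 'I_n.+1 -> G), injective (fun i => act (g i) x) ->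
          exists i, (S.1 `|` S.2) (act (g i) x)].
Proof.
move=> cG dP cX dimX actP clC clD CD0.
(* Separating C and D is the case of n+1 equal pairs of closed sets. *)
have [S0 [S0sep CS0 DS0]] : exists S0 : set X * set X,
    [/\ separated_opens S0, C `<=` S0.1 & D `<=` S0.2].
  have [S [Ssep CS DS _]] := @empty_intersection_of_partitions R X d n
    (fun=> C) (fun=> D) dP cX dimX (fun=> clC) (fun=> clD) (fun=> CD0).
  by exists (S ord0); split; [exact: Ssep|exact: CS|exact: DS].
have [base [obase baseP]] := metric_countable_base dP cX.
have /countable_injP[code codeI] := cG.
(* As code is injective, k is the number of at most one task. *)
pose meets (k : nat) (S : set X * set X) :=
  forall o (g : 'I_n.+1 -> G), k = pickle (o, [ffun i => code (g i)]) ->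
  disjoint_translates act g (closure (base o)) ->
  forall x, base o x -> exists i, (S.1 `|` S.2) (act (g i) x).
have step (kS : nat * (set X * set X)) : exists S' : set X * set X,
    separated_opens kS.2 ->
    [/\ separated_opens S', extends kS.2 S' & meets kS.1 S'].
  case: kS => k S /=; have [sepS|] := pselect (separated_opens S); last first.
    by exists S.
  have [[l [g [kE gdisj]]]|none] := pselect (exists o (g : 'I_n.+1 -> G),
      k = pickle (o, [ffun i => code (g i)]) /\
      disjoint_translates act g (closure (base o))); last first.
    exists S => _; split=> [//|//|o g kE gdisj]; first by split.
    by exfalso; apply: none; exists o, g.
  have [S' [sepS' SS' S'g]] :=
    extend_off_translates dP cX dimX actP (obase l) gdisj sepS.
  exists S' => _; split=> // o' g'.
  rewrite kE => /(pcan_inj pickleK)[<- gg'] _ x Ox.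
  have -> : g' = g; last exact: S'g.
  apply/funext => i; apply: codeI; rewrite ?inE//.
  by move/ffunP/(_ i) : gg'; rewrite !ffunE.
have [F FP] := choice step.
pose S := fix S k := if k is k'.+1 then F (k', S k') else S0.
have Ssep k : separated_opens (S k).
  by elim: k => [//|k IH]; have [] := FP (k, S k) IH.
have Smono k l : (k <= l)%N -> extends (S k) (S l).
  elim: l => [|l IH]; first by rewrite leqn0 => /eqP ->; split.
  rewrite leq_eqVlt => /orP[/eqP ->|/IH[kl1 kl2]]; first by split.
  have [_ [l1 l2] _] := FP (l, S l) (Ssep l).
  by split; [exact: subset_trans kl1 l1|exact: subset_trans kl2 l2].
exists (\bigcup_k (S k).1, \bigcup_k (S k).2); split=> /=.
- split.
  + by apply: bigcup_open => k _; case: (Ssep k).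
  + by apply: bigcup_open => k _; case: (Ssep k).
  apply/seteqP; split=> // x [[k _ xk] [l _ xl]].
  have [xm _] := Smono _ _ (leq_maxl k l).
  have [_ xm'] := Smono _ _ (leq_maxr k l).
  have [_ _ <-] := Ssep (maxn k l).
  by split; apply: subset_closure; [exact: xm|exact: xm'].
- by move=> x /CS0 Sx; exists 0%N.
- by move=> x /DS0 Sx; exists 0%N.
move=> x g gx.
have [A Ax Adisj] := nbhs_disjoint_translates (metric_hausdorff dP) actP gx.
have [l Ox OA] := baseP x A (open_nbhs_nbhs Ax).
pose k := pickle (l, [ffun i => code (g i)]).
have [_ _ /(_ l g erefl)] := FP (k, S k) (Ssep k).
move=> /(_ (fun i j ij y z Oy Oz => Adisj i j ij y z (OA y Oy) (OA z Oz))).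
move=> /(_ x Ox)[i Si]; exists i.
by case: Si => Si; [left|right]; exists k.+1.
Qed.

(** * Closed sets that meet each orbit in few points are null *)

(** Integrate the pointwise bound on the sum of the indicators. *)
Lemma sum_measure_le_multiplicity (d : measure_display) (T : measurableType d)
    (R : realType) (mu : probability T R) (I : finType) (B : I -> set T)
    (n : nat) :
  (forall i, measurable (B i)) ->
  (forall x, #|[set i | `[< B i x >]]%SET| <= n)%N ->
  (\sum_i mu (B i) <= n%:R%:E)%E.
Proof.
move=> mB Bn.
have -> : (\sum_i mu (B i) = \int[mu]_x \sum_i (\1_(B i) x)%:E)%E.
  rewrite ge0_integral_sum//.
  - by apply: eq_bigr => i _; rewrite integral_indic// setIT.
  - by move=> i; apply/measurable_EFinP; exact: measurable_indic.
have -> : (n%:R%:E = \int[mu]_x (cst n%:R%:E x) :> \bar R)%E.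
  rewrite integral_cst//; apply/esym.
  by rewrite -[RHS]mule1; congr (_ * _)%E; exact: probability_setT.
apply: ge0_le_integral => //.
- by move=> x _; apply: sume_ge0 => i _; rewrite lee_fin.
- apply: emeasurable_sum => i.
  by apply/measurable_EFinP; exact: measurable_indic.
move=> x _; rewrite sumEFin lee_fin.
apply: (@le_trans _ _ (#|[set i | `[< B i x >]]%SET|%:R)); last first.
  by rewrite ler_nat.
rewrite -sum1_card natr_sum [leRHS]big_mkcond/=; apply: ler_sum => i _.
rewrite indicE inE.
by case: asboolP => Bx; [rewrite mem_set|rewrite memNset].
Qed.

Lemma measurable_closed_borel (X : topologicalType) (x0 : X) (A : set X) :
  closed A -> measurable (A : set (borel x0)).
Proof.
move=> clA; rewrite -[A]setCK; apply: measurableC.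
by apply: sub_sigma_algebra; rewrite /= openC.
Qed.

(** Mass transport. Fix N. Locally on X there are N group elements h_0, ...,
    h_(N-1) with disjoint translates; by compactness A splits into finitely many
    pieces A_l, each with such elements h_(l,i). The sets h_(l,i) A_l have total
    measure at least N mu(A) by invariance. They cover each x at most n times:
    if x = h_(l,i) a with a in A_l, then a determines l, as the pieces are
    disjoint, and then i, as the translates are; and there are at most n points
    a of A in the orbit of x. *)
Lemma null_of_bounded_multiplicity (R : realType) (G : groupType)
    (X : topologicalType) (act : G -> X -> X) (n : nat) (A : set X) (x0 : X)
    (mu : probability (borel x0) R) :
  hausdorff_space X -> compact [set: X] -> continuous_action act ->
  (forall x, infinite_set (range (act ^~ x))) ->
  closed A ->
  (forall x (g : 'I_n.+1 -> G), injective (fun i => act (g i) x) ->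
    exists i, ~ A (act (g i) x)) ->
  invariant_measure act mu -> mu A = 0%E.
Proof.
move=> hX cX actP orbI clA An muI; have [act1 actM ctsact] := actP.
have actKV h x : act h (act (h^-1)%g x) = x by rewrite -actM mulgV act1.
have mA := @measurable_closed_borel X x0 A clA.
suff muA N : (N%:R%:E * mu A <= n%:R%:E)%E.
  have muAfin : mu A \is a fin_num.
    exact: (@fin_num_measure _ _ _ mu A mA).
  apply/eqP; rewrite eq_le measure_ge0 andbT leNgt; apply/negP => muA0.
  move: muA muA0; rewrite -(fineK muAfin) lte_fin => muA a0.
  have := muA (Num.bound (n%:R / fine (mu A))).
  rewrite -EFinM lee_fin leNgt -ltr_pdivrMr// archi_boundP//.
  by rewrite divr_ge0// ltW.
have /choice[h hP] (y : X) : exists h : 'I_N -> G,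
    injective (fun i => act (h i) y).
  have [E Eorb EN] := infinite_set_fset N (orbI y).
  pose p (i : 'I_N) := nth y (finmap.enum_fset E) i.
  have /choice[e eP] (i : 'I_N) : exists g, act g y = p i.
    have [|g _ gy] := Eorb (p i); last by exists g.
    by apply: mem_nth; exact: leq_trans (ltn_ord i) EN.
  exists e => i j; rewrite !eP /p => /eqP.
  rewrite nth_uniq ?finmap.fset_uniq ?(leq_trans (ltn_ord _) EN)// => /eqP.
  exact: val_inj.
have /choice[W WP] (y : X) : exists W,
    open_nbhs y W /\ disjoint_translates act (h y) W.
  by have [W ? ?] := nbhs_disjoint_translates hX actP (hP y); exists W.
have [y|s sP] := @finite_nbhs_subcover X W cX.
  by apply: open_nbhs_nbhs; have [] := WP y.
pose w l := nth x0 s l.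
(* The pieces A_l = F l `&` W (w l) are disjoint: F l removes the earlier W. *)
pose F l := (A `&` ~` \bigcup_(k in `I_l) W (w k)).
pose Al l := F l `&` W (w l).
have clF l : closed (F l).
  apply: closedI => //; rewrite closedC; apply: bigcup_open => k _.
  by have [[]] := WP (w k).
have Acover : A `<=` \big[setU/set0]_(l < size s) Al l.
  move=> y Ay; rewrite -bigcup_mkord.
  have [c cs Wy] := sP y.
  have hasP : has (fun x => `[< W x y >]) s.
    by apply/hasP; exists c => //; exact/asboolP.
  exists (find (fun x => `[< W x y >]) s); first by rewrite /= -has_find.
  split; last by apply/asboolP; exact: (nth_find x0 hasP).
  split=> // -[k /= kl Wk]; have := before_find x0 kl.
  by move/negP; apply; exact/asboolP.
(* The translate h_(l,i) A_l, written as a preimage. *)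
pose B (t : 'I_(size s) * 'I_N) := act ((h (w t.1) t.2)^-1)%g @^-1` Al t.1.
have mAl l : measurable (Al l : set (borel x0)).
  apply: measurableI; first exact: measurable_closed_borel.
  by apply: sub_sigma_algebra; have [[]] := WP (w l).
have mB t : measurable (B t : set (borel x0)).
  rewrite /B preimage_setI; apply: measurableI.
    apply: measurable_closed_borel.
    by move/continuous_closedP : (ctsact ((h (w t.1) t.2)^-1)%g); apply.
  apply: sub_sigma_algebra.
  move/continuousP : (ctsact ((h (w t.1) t.2)^-1)%g); apply.
  by have [[]] := WP (w t.1).
have Bn x : (#|[set t | `[< B t x >]]%SET| <= n)%N.
  rewrite leqNgt; apply/negP => nB.
  set E := [set t | `[< B t x >]]%SET in nB.
  pose t (i : 'I_n.+1) := enum_val (widen_ord nB i).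
  pose g i := ((h (w (t i).1) (t i).2)^-1)%g.
  have tB i : B (t i) x.
    by apply/asboolP; have := enum_valP (widen_ord nB i); rewrite inE.
  have [|i] := An x g; last by apply; have [[]] := tB i.
  move=> i j gij; suff : t i = t j.
    by move=> /enum_val_inj/(congr1 val) ij; apply: val_inj.
  have [[_ /= Fi] Wi] := tB i; have [[_ /= Fj] Wj] := tB j.
  have t1 : (t i).1 = (t j).1.
    apply: val_inj; have [ij|ji|//] := ltngtP (val (t i).1) (val (t j).1).
      by exfalso; apply: Fj; exists (val (t i).1) => //; rewrite -[act _ x]gij.
    by exfalso; apply: Fi; exists (val (t j).1) => //; rewrite [act _ x]gij.
  have [t2|t2] := eqVneq (t i).2 (t j).2.
    by rewrite [LHS]surjective_pairing [RHS]surjective_pairing t1 t2.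
  have [_ dW] := WP (w (t i).1).
  exfalso; apply: (dW _ _ t2 _ _ Wi Wi); rewrite actKV.
  by rewrite [in X in act X _]t1 [in RHS]gij actKV.
apply: le_trans (sum_measure_le_multiplicity mu mB Bn).
have -> : (\sum_t mu (B t) = N%:R%:E * \sum_(l < size s) mu (Al l))%E.
  rewrite ge0_sume_distrr; last by move=> l _; exact: measure_ge0.
  rewrite -(pair_bigA _ (fun l i => mu (B (l, i))))/=; apply: eq_bigr => l _.
  under eq_bigr => i _ do rewrite /B /= muI//.
  rewrite -(@fineK _ (mu (Al l))).
    by rewrite sumEFin -EFinM sumr_const card_ord mulr_natl.
  exact: (@fin_num_measure _ _ _ mu _ (mAl l)).
apply: lee_wpmul2l; first by rewrite lee_fin.
apply: le_trans (Boole_inequality mu (fun i _ => mAl i)).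
apply: le_measure => //; rewrite ?inE; first exact: measurable_closed_borel.
by apply: bigsetU_measurable.
Qed.

(** * The small boundary property *)

Theorem corollaryE (R : realType) (G : groupType) (X : topologicalType)
    (act : G -> X -> X)
    (countableG : countable [set: G])
    (compactX : compact [set: X])
    (metrizableX : metrizable X R)
    (finite_dimX : finite_covering_dim X)
    (actP : continuous_action act)
    (minimalP : minimal_action act) :
  small_boundary_property act R.
Proof.
have [d dP] : exists d, @compatible_metric R X d by [].
have hX := metric_hausdorff dP.
have accX := hausdorff_accessible hX.
have [n dimX] := finite_dimX.
have [act1 actM _] := actP.
have [[x0 finx0]|inforb] :=
    pselect (exists x, finite_set (range (act ^~ x))).
  have XE : range (act ^~ x0) = [set: X].
    have [| |X0|//] := minimalP (range (act ^~ x0)).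
    - exact: (accessible_finite_set_closed.1 accX).
    - move=> g; apply/seteqP; split=> [_ [_ [h _ <-] <-]|_ [h _ <-]].
        by exists (g * h)%g => //; rewrite actM.
      exists (act (g^-1 * h)%g x0); first by exists (g^-1 * h)%g.
      by rewrite -actM mulgA mulgV mul1g.
    - suff : set0 x0 by [].
      by rewrite -X0; exists 1%g => //; exact: act1.
  exists (@open X).
    by split=> // x A; rewrite nbhsE => -[U [oU Ux] UA]; exists U.
  move=> U oU y mu _; rewrite (_ : boundary U = set0) ?measure0//.
  have clU : closed U.
    apply: (accessible_finite_set_closed.1 accX).
    by apply: sub_finite_set finx0; rewrite XE.
  by rewrite /boundary -((closure_id _).1 clU) ((interior_id _).1 oU) setDv.
have orbI x : infinite_set (range (act ^~ x)).
  by move=> finx; apply: inforb; exists x.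
exists [set U : set X | open U /\
    forall (x0 : X) (mu : probability (borel x0) R),
      invariant_measure act mu -> mu (boundary U) = 0%E]; last first.
  by move=> U [].
split=> [U []//|x A]; rewrite nbhsE => -[V [oV Vx] VA].
have clx : closed [set x].
  by apply: (accessible_finite_set_closed.1 accX); exact: finite_set1.
have [||[U U'] [[/= oU oU' UU'0] xU VU' orbU]] :=
  @bounded_multiplicity_partition R G X d act n [set x] (~` V) countableG dP
    compactX dimX actP clx.
- by rewrite closedC.
- by apply/seteqP; split=> // y [/= ->].
have clUU' : closure U `<=` ~` U'.
  have clU' : closed (~` U') by rewrite closedC.
  rewrite [X in _ `<=` X]((closure_id _).1 clU'); apply: closureS => y Uy U'y.
  by have : (U `&` U') y by []; rewrite UU'0.
exists U; last first.
  move=> y Uy; apply: VA; apply: contrapT => Vy.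
  by have : (U `&` U') y; [split=> //; exact: VU'|rewrite UU'0].
split; last exact: xU.
split=> // x0 mu muI.
apply: (@null_of_bounded_multiplicity R G X act n _ x0 mu hX) => //.
  rewrite /boundary ((interior_id _).1 oU); apply: closedI.
    exact: closed_closure.
  by rewrite closedC.
move=> y g /orbU[i UU']; exists i.
rewrite /boundary ((interior_id _).1 oU) => -[clUy Uy].
by case: UU' => //; exact: clUU'.
Qed.
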